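(* Fix $d\ge2$. Let $\mathcal{H}$ be a nc reproducing kernel Hilbert space on the nc unit polydisk $\mathfrak{D}_d$ that contains the free nc polynomials, and for which the nc monomials form an orthogonal basis. Then $\operatorname{Mult}(\mathcal{H})\ne H^\infty(\mathfrak{D}_d)$.
   Context: $M_n^d$ is the set of $d$-tuples of complex $n\times n$ matrices ($M_n=M_n^1$); $\mathbb{M}^d=\sqcup_{n\ge1}M_n^d$; for $\Omega\subseteq\mathbb{M}^d$, $\Omega(n)=\Omega\cap M_n^d$. A nc function $f:\Omega\to\mathbb{M}^1$ on a set $\Omega$ closed under direct sums (a nc set) is a graded map ($X\in\Omega(n)\Rightarrow f(X)\in M_n$) with $f(X\oplus Y)=f(X)\oplus f(Y)$ and $f(S^{-1}XS)=S^{-1}f(X)S$ whenever $S\in GL_n$ and $X,S^{-1}XS\in\Omega(n)$. The nc unit polydisk is $\mathfrak{D}_d=\sqcup_n\{X\in M_n^d:\max_j\|X_j\|<1\}$. $H^\infty(\mathfrak{D}_d)$ is the algebra of bounded nc functions $\mathfrak{D}_d\to\mathbb{M}^1$ with the sup norm (and matrix norms $\|[f_{jk}]\|=\sup_X\|[f_{jk}(X)]\|$). A nc reproducing kernel Hilbert space on a nc set $\Omega$ is a Hilbert space $\mathcal{H}$ of nc functions $\Omega\to\mathbb{M}^1$ such that for all $n$, $X\in\Omega(n)$ and $v,y\in\mathbb{C}^n$ there is $K_{X,v,y}\in\mathcal{H}$ with $\langle h(X)v,y\rangle_{\mathbb{C}^n}=\langle h,K_{X,v,y}\rangle_{\mathcal{H}}$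 for all $h\in\mathcal{H}$. $\operatorname{Mult}(\mathcal{H})$ is the algebra of (left) multipliers: nc functions $f:\Omega\to\mathbb{M}^1$ such that the pointwise product $f\cdot h$ lies in $\mathcal{H}$ for all $h\in\mathcal{H}$, with $M_fh=f\cdot h$ (normed by the operator norm of $M_f$). The nc monomials are $Z^\alpha=Z_{\alpha_1}\cdots Z_{\alpha_k}$ for words $\alpha$ in the letters $1,\dots,d$. *)

(* Defs.v *)
From HB Require Import structures.
From mathcomp Require Import all_boot all_order all_algebra.
From mathcomp Require Import complex ring lra.
From mathcomp Require Import all_classical all_reals all_analysis.

Set Implicit Arguments.
Unset Strict Implicit.
Unset Printing Implicit Defensive.

Import Order.TTheory GRing.Theory Num.Theory.
Import numFieldNormedType.Exports.

Local Open Scope classical_set_scope.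
Local Open Scope ring_scope.

Section EuclideanNorms.
Variable R : realType.
Implicit Types m n : nat.

Definition cdot n (v y : 'cV[R[i]]_n) : R[i] :=
  \sum_(i < n) v i 0 * Num.conj (y i 0).

Definition l2norm n (v : 'cV[R[i]]_n) : R := Num.sqrt (complex.Re (cdot v v)).

Definition opnorm n (A : 'M[R[i]]_n) : R :=
  sup [set l2norm (A *m v) | v in [set v : 'cV[R[i]]_n | l2norm v <= 1]].

Fact cdot_Re n (v : 'cV[R[i]]_n) :
  complex.Re (cdot v v) =
  \sum_(i < n) (complex.Re (v i 0) ^+ 2 + complex.Im (v i 0) ^+ 2).
Proof.
rewrite /cdot (raddf_sum (@complex.Re R)) /=; apply: eq_bigr => i _.
by case: (v i 0) => a b /=; rewrite mulrN opprK !expr2.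
Qed.

Fact l2norm_ge0 n (v : 'cV[R[i]]_n) : 0 <= l2norm v.
Proof. exact: sqrtr_ge0. Qed.

Fact l2norm_sqr n (v : 'cV[R[i]]_n) : l2norm v ^+ 2 = complex.Re (cdot v v).
Proof.
rewrite sqr_sqrtr // cdot_Re; apply: sumr_ge0 => i _.
by rewrite addr_ge0 ?sqr_ge0.
Qed.

Fact l2norm_col_mx n m (v : 'cV[R[i]]_n) (w : 'cV[R[i]]_m) :
  l2norm (col_mx v w) ^+ 2 = l2norm v ^+ 2 + l2norm w ^+ 2.
Proof.
rewrite !l2norm_sqr !cdot_Re big_split_ord /=; congr (_ + _);
  apply: eq_bigr => i _; first by rewrite col_mxEu.
by rewrite col_mxEd.
Qed.

Fact cdotE n (v : 'cV[R[i]]_n) : cdot v v = \sum_(i < n) `|v i 0| ^+ 2.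
Proof. by apply: eq_bigr => i _; rewrite -normCK. Qed.

Fact l2norm_sqrC n (v : 'cV[R[i]]_n) : ((l2norm v ^+ 2)%:C)%C = cdot v v.
Proof.
rewrite l2norm_sqr; apply: RRe_real.
by rewrite cdotE ger0_real // sumr_ge0 // => i _; rewrite exprn_ge0.
Qed.

Fact l2norm_scale n (a : R) (v : 'cV[R[i]]_n) :
  0 <= a -> l2norm (a%:C%C *: v) = a * l2norm v.
Proof.
move=> a0; apply/eqP; rewrite -(@eqrXn2 _ 2) ?mulr_ge0 ?l2norm_ge0 //.
rewrite exprMn !l2norm_sqr !cdot_Re mulr_sumr; apply/eqP/eq_bigr => i _.
by rewrite mxE; case: (v i 0) => x y /=; ring.
Qed.

Fact l2norm_coord n (v : 'cV[R[i]]_n) (i : 'I_n) :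
  l2norm v <= 1 -> `|v i 0| <= 1.
Proof.
move=> v1; rewrite -(@expr_le1 _ 2) //.
have : ((l2norm v ^+ 2)%:C <= 1)%C.
  by rewrite (lecR _ 1) expr_le1 ?l2norm_ge0.
rewrite l2norm_sqrC cdotE; apply: le_trans.
by rewrite (bigD1 i) //= lerDl sumr_ge0 // => k _; rewrite exprn_ge0.
Qed.

Fact opnorm_has_sup n (A : 'M[R[i]]_n) :
  has_sup [set l2norm (A *m v) | v in [set v : 'cV[R[i]]_n | l2norm v <= 1]].
Proof.
split.
  exists (l2norm (A *m 0)), 0 => //=.
  rewrite -(@ler_pXn2r _ 2) ?nnegrE ?l2norm_ge0 // l2norm_sqr cdot_Re big1.
    by rewrite expr1n.
  by move=> i _; rewrite mxE /= expr0n addr0.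
pose M : R[i] := \sum_i (\sum_j `|A i j|) ^+ 2.
exists (1 + complex.Re M) => _ [v /= v1 <-].
have M0 : 0 <= M.
  by apply: sumr_ge0 => i _; rewrite exprn_ge0 // sumr_ge0.
have MR : ((complex.Re M)%:C = M)%C by apply: RRe_real; rewrite ger0_real.
have ReM0 : 0 <= complex.Re M by rewrite -(lecR 0) MR.
have : l2norm (A *m v) ^+ 2 <= complex.Re M.
  rewrite -lecR MR l2norm_sqrC cdotE; apply: ler_sum => i _.
  rewrite lerXn2r ?nnegrE ?sumr_ge0 // mxE.
  apply: le_trans (ler_norm_sum _ _ _) _; apply: ler_sum => j _.
  by rewrite normrM ler_piMr // l2norm_coord.
move=> h; rewrite -(@ler_pXn2r _ 2) ?nnegrE ?l2norm_ge0 ?addr_ge0 //.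
by apply: le_trans h _; nra.
Qed.

Fact opnorm_ge0 n (A : 'M[R[i]]_n) : 0 <= opnorm A.
Proof.
have [[x Ax] ub] := opnorm_has_sup A.
apply: le_trans (ub_le_sup ub Ax).
by case: Ax => v _ <-; exact: l2norm_ge0.
Qed.

Fact opnormP n (A : 'M[R[i]]_n) (v : 'cV[R[i]]_n) :
  l2norm (A *m v) <= opnorm A * l2norm v.
Proof.
have le1 w : l2norm w <= 1 -> l2norm (A *m w) <= opnorm A.
  by move=> w1; apply: (ub_le_sup (opnorm_has_sup A).2); exists w.
have [v0|v0] := eqVneq (l2norm v) 0.
  have -> : v = 0.
    apply/matrixP => i j; rewrite ord1 mxE.
    have := l2norm_sqrC v; rewrite v0 expr0n /= cdotE => /esym/eqP.
    rewrite psumr_eq0 => [/allP/(_ i)|k _]; last by rewrite exprn_ge0.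
    by rewrite mem_index_enum sqrf_eq0 normr_eq0 => /(_ isT)/eqP.
  rewrite mulmx0 (_ : 0 = (0 : R)%:C%C *: (0 : 'cV[R[i]]_n)) ?scaler0 //.
  by rewrite -(scaler0 _ (0 : R)%:C%C) l2norm_scale // mul0r mulr0.
have vgt0 : 0 < l2norm v by rewrite lt_def v0 l2norm_ge0.
have vi0 : 0 <= (l2norm v)^-1 by rewrite invr_ge0 ltW.
have := le1 ((l2norm v)^-1%:C%C *: v).
rewrite -scalemxAr !l2norm_scale // mulVf // lexx => /(_ isT).
by rewrite mulrC ler_pdivrMr.
Qed.

Fact opnorm_le n (A : 'M[R[i]]_n) (c : R) :
  0 <= c -> (forall v, l2norm (A *m v) <= c * l2norm v) -> opnorm A <= c.
Proof.
move=> c0 Ac; apply: ge_sup => [|_ [v v1 <-]]; first exact: (opnorm_has_sup A).1.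
by apply: le_trans (Ac v) _; rewrite ler_piMr.
Qed.

Fact opnorm_dsum n m (A : 'M[R[i]]_n) (B : 'M[R[i]]_m) :
  opnorm (block_mx A 0 0 B) <= Num.max (opnorm A) (opnorm B).
Proof.
have c0 : 0 <= Num.max (opnorm A) (opnorm B) by rewrite le_max opnorm_ge0.
apply: opnorm_le => // v; rewrite -(vsubmxK v) mul_block_col !mul0mx addr0 add0r.
rewrite -(@ler_pXn2r _ 2) ?nnegrE ?mulr_ge0 ?l2norm_ge0 //.
rewrite exprMn !l2norm_col_mx mulrDr -!exprMn lerD //;
  rewrite lerXn2r ?nnegrE ?mulr_ge0 ?l2norm_ge0 //;
  apply: le_trans (opnormP _ _) _; rewrite ler_wpM2r ?l2norm_ge0 //.
  by rewrite le_max lexx.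
by rewrite le_max lexx orbT.
Qed.

End EuclideanNorms.

Section NcSets.
Variables (R : realType) (d : nat).

Definition mxtuple n : Type := 'I_d -> 'M[R[i]]_n.

Definition dsum n m (X : mxtuple n) (Y : mxtuple m) : mxtuple (n + m) :=
  fun j => block_mx (X j) 0 0 (Y j).

(* The levels of a nc set start at n = 1, hence the emptiness of level 0. *)
Record ncset := NcSet {
  ncset_level :> forall n, set (mxtuple n);
  ncset_level0 : @ncset_level 0 = set0;
  ncset_dsum : forall n m (X : mxtuple n) (Y : mxtuple m),
    @ncset_level n X -> @ncset_level m Y ->
    @ncset_level (n + m)%N (dsum X Y) }.

End NcSets.

Arguments ncset_level {R d} Omega n : rename.

Section Polydisk.
Variables (R : realType) (d : nat).

Definition polydisk_level n : set (mxtuple R d n) :=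
  [set X | (0 < n)%N /\ \big[Num.max/0]_(j < d) opnorm (X j) < 1].

Fact polydisk_level0 : @polydisk_level 0 = set0.
Proof. by apply/seteqP; split => // X []. Qed.

Fact polydisk_dsum n m (X : mxtuple R d n) (Y : mxtuple R d m) :
  polydisk_level X -> polydisk_level Y -> polydisk_level (dsum X Y).
Proof.
move=> [n0 X1] [m0 Y1]; split; first by rewrite addn_gt0 n0.
have lt1 k (Z : mxtuple R d k) :
    \big[Num.max/0]_(j < d) opnorm (Z j) < 1 <-> forall j, opnorm (Z j) < 1.
  split => [Z1 j|Z1]; first by apply: le_lt_trans Z1; exact: le_bigmax.
  by apply: bigmax_lt.
apply/lt1 => j; apply: le_lt_trans (opnorm_dsum _ _) _.
by rewrite gt_max; move/lt1: X1 => ->; move/lt1: Y1 => ->.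
Qed.

Definition polydisk : ncset R d := NcSet polydisk_level0 polydisk_dsum.

End Polydisk.

Section GradedFunctions.
Variables (R : realType) (d : nat) (Omega : ncset R d).

(* Graded maps Omega -> M^1.  They are defined on Omega only (each level is
   coerced to the subtype of its elements), so that equality of graded maps is
   pointwise equality on Omega. *)
Definition gfun : Type := forall n, Omega n -> 'M[R[i]]_n.

HB.instance Definition _ := gen_eqMixin gfun.
HB.instance Definition _ := gen_choiceMixin gfun.

Implicit Types f g h : gfun.

Lemma gfunP f g : (forall n (X : Omega n), f n X = g n X) -> f = g.
Proof.
by move=> fg; apply: functional_extensionality_dep => n; apply/funext => X.
Qed.

Definition gfun_zero : gfun := fun n _ => 0.
Definition gfun_one : gfun := fun n _ => 1.
Definition gfun_opp f : gfun := fun n X => - f n X.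
Definition gfun_add f g : gfun := fun n X => f n X + g n X.
Definition gfun_mul f g : gfun := fun n X => f n X * g n X.
Definition gfun_scale (a : R[i]) f : gfun := fun n X => a *: f n X.

Fact gfun_addA : associative gfun_add.
Proof. by move=> f g h; apply: gfunP => n X; exact: addrA. Qed.
Fact gfun_addC : commutative gfun_add.
Proof. by move=> f g; apply: gfunP => n X; exact: addrC. Qed.
Fact gfun_add0 : left_id gfun_zero gfun_add.
Proof. by move=> f; apply: gfunP => n X; exact: add0r. Qed.
Fact gfun_addN : left_inverse gfun_zero gfun_opp gfun_add.
Proof. by move=> f; apply: gfunP => n X; exact: addNr. Qed.

HB.instance Definition _ :=
  GRing.isZmodule.Build gfun gfun_addA gfun_addC gfun_add0 gfun_addN.

Fact gfun_mulA : associative gfun_mul.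
Proof. by move=> f g h; apply: gfunP => n X; exact: mulrA. Qed.
Fact gfun_mul1f : left_id gfun_one gfun_mul.
Proof. by move=> f; apply: gfunP => n X; exact: mul1r. Qed.
Fact gfun_mulf1 : right_id gfun_one gfun_mul.
Proof. by move=> f; apply: gfunP => n X; exact: mulr1. Qed.
Fact gfun_mulDl : left_distributive gfun_mul +%R.
Proof. by move=> f g h; apply: gfunP => n X; exact: mulrDl. Qed.
Fact gfun_mulDr : right_distributive gfun_mul +%R.
Proof. by move=> f g h; apply: gfunP => n X; exact: mulrDr. Qed.

HB.instance Definition _ := GRing.Zmodule_isPzRing.Build gfun
  gfun_mulA gfun_mul1f gfun_mulf1 gfun_mulDl gfun_mulDr.

Fact gfun_scaleA a b f : gfun_scale a (gfun_scale b f) = gfun_scale (a * b) f.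
Proof. by apply: gfunP => n X; exact: scalerA. Qed.
Fact gfun_scale1 : left_id 1 gfun_scale.
Proof. by move=> f; apply: gfunP => n X; exact: scale1r. Qed.
Fact gfun_scaleDr : right_distributive gfun_scale +%R.
Proof. by move=> a f g; apply: gfunP => n X; exact: scalerDr. Qed.
Fact gfun_scaleDl f : {morph gfun_scale^~ f : a b / a + b}.
Proof. by move=> a b; apply: gfunP => n X; exact: scalerDl. Qed.

HB.instance Definition _ := GRing.Zmodule_isLmodule.Build R[i] gfun
  gfun_scaleA gfun_scale1 gfun_scaleDr gfun_scaleDl.

Definition is_nc f : Prop :=
  (forall n m (X : Omega n) (Y : Omega m) (Z : Omega (n + m)%N),
     \val Z = dsum (\val X) (\val Y) ->
     f _ Z = block_mx (f n X) 0 0 (f m Y)) /\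
  (forall n (X Y : Omega n) (S : 'M[R[i]]_n), S \in unitmx ->
     (forall j, \val Y j = invmx S *m \val X j *m S) ->
     f n Y = invmx S *m f n X *m S).

Definition Hinfty : set gfun :=
  [set f | is_nc f /\
     exists M : R, forall n (X : Omega n), opnorm (f n X) <= M].

Definition ncvar (j : 'I_d) : gfun := fun n X => \val X j.

Definition ncmonomial (w : seq 'I_d) : gfun := \prod_(j <- w) ncvar j.

Definition ncpolynomials : set gfun :=
  [set p | exists s : seq (R[i] * seq 'I_d),
     p = \sum_(t <- s) t.1 *: ncmonomial t.2].

End GradedFunctions.

Arguments ncvar {R d} Omega j.
Arguments ncmonomial {R d} Omega w.
Arguments ncpolynomials {R d} Omega _.
Arguments Hinfty {R d} Omega _.

Section HilbertSpaces.
Variable R : realType.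

(* Complex Hilbert spaces; the inner product is linear in its first variable. *)
Record hilbert := Hilbert {
  hilbert_space :> completeNormedModType R[i];
  inner : {dot hilbert_space for Num.conj};
  inner_norm : forall h : hilbert_space, `|h| ^+ 2 = inner h h }.

Definition orthogonal_basis (H : hilbert) (I : Type) (e : I -> H) : Prop :=
  [/\ forall i, e i != 0,
      forall i j, i <> j -> inner H (e i) (e j) = 0 &
      dense [set u : H | exists s : seq (R[i] * I),
                           u = \sum_(t <- s) t.1 *: e t.2]].

End HilbertSpaces.

Section NcRKHS.
Variables (R : realType) (d : nat) (Omega : ncset R d).

(* A Hilbert space whose elements are nc functions: an element h is identified
   with the function [ncrkhs_fun h], faithfully since this map is injective. *)
Record ncRKHS := NcRKHS {
  ncrkhs_hilbert :> hilbert R;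
  ncrkhs_fun : {linear ncrkhs_hilbert -> gfun Omega};
  ncrkhs_inj : injective ncrkhs_fun;
  ncrkhs_nc : forall h, is_nc (ncrkhs_fun h);
  ncrkhs_kernel : forall n (X : Omega n) (v y : 'cV[R[i]]_n),
    exists K : ncrkhs_hilbert, forall h : ncrkhs_hilbert,
      cdot (ncrkhs_fun h n X *m v) y = inner ncrkhs_hilbert h K }.

Definition ncrkhs_functions (H : ncRKHS) : set (gfun Omega) :=
  range (ncrkhs_fun H).

Definition Mult (H : ncRKHS) : set (gfun Omega) :=
  [set f | is_nc f /\
     forall h, ncrkhs_functions H h -> ncrkhs_functions H (f * h)].

Definition monomials_orthogonal_basis (H : ncRKHS) : Prop :=
  exists e : seq 'I_d -> H,
    (forall w, ncrkhs_fun H (e w) = ncmonomial Omega w) /\ orthogonal_basis e.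

End NcRKHS.

(* Main.v *)
(* If Mult(H) = H^infty, then H^infty is contained in H, since 1 lies in H.  Put
   r = 9/10.  By orthogonality the sum g_k of the d^k monomials of length k has
   squared norm equal to the sum of the squared norms of these monomials, while
   its value at the scalar point (r,...,r) is (dr)^k; since evaluation there is
   bounded, some monomial Z^(w_k) of length k has squared norm at least
   (d r^2)^k / c for a constant c.  The series of the r^k Z^(w_k) lies in
   H^infty, because monomials are bounded by 1 on the polydisk, hence in H.
   Its coefficient at Z^(w_k) is r^k, so r^(2k) |Z^(w_k)|^2 is bounded in k,
   which is absurd since d r^4 > 1 for d >= 2.

   The coefficient at Z^w of an element of H is an entry of its value at a
   nilpotent tuple that walks along w; by density of the polynomials, it is the
   inner product with a multiple of Z^w. *)
Require Import Defs.
From mathcomp Require Import all_boot all_order all_algebra.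
From mathcomp Require Import complex ring lra.
From mathcomp Require Import all_classical all_reals all_analysis.

Set Implicit Arguments.
Unset Strict Implicit.
Unset Printing Implicit Defensive.

Import Order.TTheory GRing.Theory Num.Theory.
Import numFieldNormedType.Exports.

Local Open Scope classical_set_scope.
Local Open Scope ring_scope.

(* [CauchySchwarz] in the library is limited to finite dimension. *)
Lemma cauchy_schwarz (C : numClosedFieldType) (U : lmodType C)
    (form : {dot U for Num.conj}) (u v : U) :
  `|form u v| ^+ 2 <= form u u * form v v.
Proof.
have [->|v0] := eqVneq v 0; first by rewrite !linear0r normr0 expr0n.
have vv0 : 0 < form v v by exact: neq0_dnorm_gt0.
have [a avv] : exists a, a * form v v = form u v.
  by exists (form u v / form v v); rewrite divfK ?gt_eqF.
have uv : form v u = (form u v)^* by rewrite hermC expr0 mul1r.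
(* [a *: v] is the orthogonal projection of [u] on [v]; the remainder has nonnegative square. *)
have := dnorm_ge0 form (u - a *: v).
rewrite linearBl !linearBr !linearZl_LR !linearZr_LR /=.
rewrite uv avv (_ : _ - _ = form u u - a * (form u v)^*); last first.
  by rewrite opprB addrA addrNK.
by rewrite subr_ge0 -(ler_pM2r vv0) mulrAC avv normCK.
Qed.

(** * Inner products and orthogonality to a dense span *)

Section Hilbert.
Variables (R : realType) (H : hilbert R).

Lemma inner_ge0 (u : H) : 0 <= inner H u u.
Proof. by rewrite -inner_norm exprn_ge0. Qed.

Lemma innerBl (u v w : H) : inner H (u - v) w = inner H u w - inner H v w.
Proof. exact: (linearBl (inner H)). Qed.

Lemma innerBr (u v w : H) : inner H u (v - w) = inner H u v - inner H u w.
Proof. exact: (linearBr (inner H)). Qed.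

Lemma innerZl (a : R[i]) (u v : H) : inner H (a *: u) v = a * inner H u v.
Proof. exact: (linearZl_LR (inner H)). Qed.

Lemma innerZr (a : R[i]) (u v : H) :
  inner H u (a *: v) = Num.conj a * inner H u v.
Proof. exact: (linearZr_LR (inner H)). Qed.

Lemma inner_suml (I : Type) (r : seq I) (P : pred I) (F : I -> H) (u : H) :
  inner H (\sum_(i <- r | P i) F i) u = \sum_(i <- r | P i) inner H (F i) u.
Proof. exact: (linear_sumlz (inner H)). Qed.

Lemma inner_sumr (I : Type) (r : seq I) (P : pred I) (F : I -> H) (u : H) :
  inner H u (\sum_(i <- r | P i) F i) = \sum_(i <- r | P i) inner H u (F i).
Proof. exact: (linear_sumr (inner H)). Qed.

(** If [u] were nonzero, some combination [v] of the [e i] would satisfy [|u - v| < |u|]. Since [v]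
    is orthogonal to [u], Cauchy-Schwarz for [u - v] and [u] gives [|u|^2 <= |u - v| |u|], a
    contradiction. *)
Lemma orthogonal_dense_eq0 (I : Type) (e : I -> H) (u : H) :
  dense [set u : H | exists s : seq (R[i] * I),
                       u = \sum_(t <- s) t.1 *: e t.2] ->
  (forall i, inner H (e i) u = 0) -> u = 0.
Proof.
move=> eD eu; apply/eqP; apply/negPn/negP => u0.
have nu0 : 0 < `|u| by rewrite normr_gt0.
have B0 : ball u `|u| !=set0 by exists u; exact: ballxx.
have [v [uv [s vE]]] := eD _ B0 (ball_open u `|u|).
move: uv; rewrite -ball_normE /= => uv.
have vu : inner H v u = 0.
  rewrite vE inner_suml; apply: big1 => t _.
  by rewrite innerZl eu mulr0.
have := cauchy_schwarz (inner H) (u - v) u.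
rewrite innerBl vu subr0 -!inner_norm normrX normr_id -exprMn.
rewrite ler_pXn2r ?nnegrE ?exprn_ge0 ?mulr_ge0 //.
by rewrite expr2 ler_pM2r // => /le_lt_trans /(_ uv); rewrite ltxx.
Qed.

End Hilbert.

(** * Triangle inequality, operator norm and matrix entries *)

Section OperatorNorm.
Variable R : realType.
Implicit Types (n : nat).

Lemma l2normD n (u v : 'cV[R[i]]_n) : l2norm (u + v) <= l2norm u + l2norm v.
Proof.
(* The argument divides by [a] and [b], so the norms are first replaced by strictly positive upper
   bounds; the slack [e] is arbitrary. *)
suff key (a b : R) : 0 < a -> 0 < b -> l2norm u <= a -> l2norm v <= b ->
    l2norm (u + v) <= a + b.
  apply/ler_addgt0Pr => e e0.
  have e2 : 0 < e / 2 by rewrite divr_gt0.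
  have pos (w : 'cV[R[i]]_n) : 0 < l2norm w + e / 2.
    by rewrite ltr_wpDl ?l2norm_ge0.
  rewrite {1}(splitr e) addrACA.
  by apply: key; rewrite ?pos // ?lerDl ?(ltW e2).
move=> a0 b0 ua vb.
have a0' := lt0r_neq0 a0; have b0' := lt0r_neq0 b0.
have a0w := ltW a0; have b0w := ltW b0.
have ua2 : l2norm u ^+ 2 <= a ^+ 2 by rewrite lerXn2r ?nnegrE ?l2norm_ge0.
have vb2 : l2norm v ^+ 2 <= b ^+ 2 by rewrite lerXn2r ?nnegrE ?l2norm_ge0.
rewrite -(@ler_pXn2r _ 2) ?nnegrE ?l2norm_ge0 ?addr_ge0 //.
(* The weights make [2 x y <= (b / a) x ^ 2 + (a / b) y ^ 2] sharp at (a, b). *)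
apply: (@le_trans _ _ ((1 + b / a) * l2norm u ^+ 2 +
                       (1 + a / b) * l2norm v ^+ 2)).
  rewrite !l2norm_sqr !cdot_Re !mulr_sumr -big_split /=; apply: ler_sum => i _.
  rewrite !mxE; case: (u i 0) (v i 0) => x1 y1 [x2 y2] /=.
  have key (x y : R) :
      (x + y) ^+ 2 <= (1 + b / a) * x ^+ 2 + (1 + a / b) * y ^+ 2.
    rewrite -subr_ge0 (_ : _ - _ = (b * x - a * y) ^+ 2 / (a * b)).
      by rewrite divr_ge0 ?sqr_ge0 ?mulr_ge0.
    by field; rewrite a0' b0'.
  by rewrite !mulrDr addrACA lerD.
rewrite (_ : (a + b) ^+ 2 = (1 + b / a) * a ^+ 2 + (1 + a / b) * b ^+ 2).
  by rewrite lerD // ler_wpM2l ?addr_ge0 ?divr_ge0.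
by field; rewrite a0' b0'.
Qed.

Lemma opnormD n (A B : 'M[R[i]]_n) : opnorm (A + B) <= opnorm A + opnorm B.
Proof.
apply: opnorm_le => [|v]; first by rewrite addr_ge0 ?opnorm_ge0.
by rewrite mulmxDl mulrDl (le_trans (l2normD _ _)) ?lerD ?opnormP.
Qed.

Lemma opnormM n (A B : 'M[R[i]]_n) : opnorm (A *m B) <= opnorm A * opnorm B.
Proof.
apply: opnorm_le => [|v]; first by rewrite mulr_ge0 ?opnorm_ge0.
rewrite -mulmxA (le_trans (opnormP _ _)) // -mulrA.
by rewrite ler_wpM2l ?opnorm_ge0 ?opnormP.
Qed.

Lemma opnormZ n (a : R) (A : 'M[R[i]]_n) :
  0 <= a -> opnorm (a%:C%C *: A) <= a * opnorm A.
Proof.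
move=> a0; apply: opnorm_le => [|v]; first by rewrite mulr_ge0 ?opnorm_ge0.
by rewrite -scalemxAl l2norm_scale // -mulrA ler_wpM2l ?opnormP.
Qed.

Lemma opnorm1 n : opnorm (1%:M : 'M[R[i]]_n) <= 1.
Proof. by apply: opnorm_le => // v; rewrite mul1mx mul1r. Qed.

Lemma l2norm_delta n (j : 'I_n) : l2norm (delta_mx j 0 : 'cV[R[i]]_n) = 1.
Proof.
apply/eqP; rewrite -(@eqrXn2 _ 2) ?l2norm_ge0 // expr1n l2norm_sqr cdot_Re.
rewrite (bigD1 j) //= big1 => [|i ij]; rewrite mxE ?eqxx ?(negPf ij) /=.
  by rewrite expr1n expr0n !addr0.
by rewrite expr0n addr0.
Qed.

Lemma entry_le_opnorm n (A : 'M[R[i]]_n) (i j : 'I_n) :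
  `|A i j| <= (opnorm A)%:C%C.
Proof.
have Aij : A i j = (A *m (delta_mx j 0 : 'cV_n)) i 0 by rewrite -colE mxE.
have op0 : 0 <= (opnorm A)%:C%C by rewrite ler0c opnorm_ge0.
rewrite -(@ler_pXn2r _ 2) ?nnegrE //.
have: ((l2norm (A *m delta_mx j 0) ^+ 2)%:C <= (opnorm A ^+ 2)%:C)%C.
  rewrite lecR lerXn2r ?nnegrE ?l2norm_ge0 ?opnorm_ge0 //.
  by have := opnormP A (delta_mx j 0); rewrite l2norm_delta mulr1.
rewrite l2norm_sqrC rmorphXn /=; apply: le_trans.
rewrite cdotE Aij (bigD1 i) //= lerDl.
by rewrite sumr_ge0 // => k _; rewrite exprn_ge0.
Qed.

(** Puts a matrix entry in the form required by [ncrkhs_kernel], so that reading an entry is an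
    inner product. *)
Lemma cdot_delta n (A : 'M[R[i]]_n) (a b : 'I_n) :
  cdot (A *m delta_mx b 0) (delta_mx a 0) = A a b.
Proof.
rewrite /cdot -colE (bigD1 a) //= big1 => [|c ca].
  by rewrite !mxE !eqxx conjC1 mulr1 addr0.
by rewrite !mxE (negPf ca) conjC0 mulr0.
Qed.

End OperatorNorm.

(** * Entrywise limits of matrices and complex series *)

Section EntrywiseLimits.
Variable K : numFieldType.

Definition mx_cvg m n (A : nat -> 'M[K]_(m, n)) (L : 'M[K]_(m, n)) :=
  forall i j, (fun k => A k i j) @ \oo --> L i j.

(** The order of [K] may be partial, so [0 <= l] includes that [l] is real; both follow from
    [l = |l|], by continuity of the norm. *)
Lemma cvg_ge0 (u : nat -> K) (l : K) :
  u @ \oo --> l -> (forall k, 0 <= u k) -> 0 <= l.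
Proof.
move=> ul u0; suff -> : l = `|l| by [].
apply: (norm_cvg_unique ul); apply: cvg_trans (cvg_norm ul).
by apply: near_eq_cvg; apply: nearW => k; rewrite ger0_norm.
Qed.

Lemma cvgn_sum (I : Type) (r : seq I) (x : I -> nat -> K) (l : I -> K) :
  (forall i, x i @ \oo --> l i) ->
  (fun k => \sum_(i <- r) x i k) @ \oo --> \sum_(i <- r) l i.
Proof.
by move=> xl; apply: cvg_big => //; exact: add_continuous.
Qed.

Lemma mx_cvgMl m n p (B : 'M[K]_(m, n)) (A : nat -> 'M[K]_(n, p)) L :
  mx_cvg A L -> mx_cvg (fun k => B *m A k) (B *m L).
Proof.
move=> AL i j; rewrite mxE; under eq_fun do rewrite mxE.
by apply: cvgn_sum => l; apply: cvgMl_tmp; exact: AL.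
Qed.

Lemma mx_cvgMr m n p (B : 'M[K]_(n, p)) (A : nat -> 'M[K]_(m, n)) L :
  mx_cvg A L -> mx_cvg (fun k => A k *m B) (L *m B).
Proof.
move=> AL i j; rewrite mxE; under eq_fun do rewrite mxE.
by apply: cvgn_sum => l; apply: cvgMr_tmp; exact: AL.
Qed.

Lemma mx_cvg_block m n (A : nat -> 'M[K]_m) (B : nat -> 'M[K]_n) L M :
  mx_cvg A L -> mx_cvg B M ->
  mx_cvg (fun k => block_mx (A k) 0 0 (B k)) (block_mx L 0 0 M).
Proof.
move=> AL BM i j; rewrite -(splitK i) -(splitK j).
case: (fintype.split i) => i'; case: (fintype.split j) => j' /=.
- by rewrite block_mxEul; under eq_fun do rewrite block_mxEul; exact: AL.
- rewrite block_mxEur mxE; under eq_fun do rewrite block_mxEur mxE.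
  exact: cvg_cst.
- rewrite block_mxEdl mxE; under eq_fun do rewrite block_mxEdl mxE.
  exact: cvg_cst.
- by rewrite block_mxEdr; under eq_fun do rewrite block_mxEdr; exact: BM.
Qed.

Lemma mx_cvg_unique m n (A : nat -> 'M[K]_(m, n)) L L' :
  mx_cvg A L -> mx_cvg A L' -> L = L'.
Proof.
move=> AL AL'; apply/matrixP => i j.
exact: norm_cvg_unique (AL i j) (AL' i j).
Qed.

Lemma mx_cvg_sqnorm_le n (v : nat -> 'cV[K]_n) (w : 'cV[K]_n) (c : K) :
  mx_cvg v w -> (forall k, \sum_i `|v k i 0| ^+ 2 <= c) ->
  \sum_i `|w i 0| ^+ 2 <= c.
Proof.
move=> vw vc; rewrite -subr_ge0.
apply: (@cvg_ge0 (fun k => c - \sum_i `|v k i 0| ^+ 2)) => [|k].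
  apply: cvgB; first exact: cvg_cst.
  apply: cvgn_sum => i; rewrite expr2; under eq_fun do rewrite expr2.
  by apply: cvgM; apply: cvg_norm; exact: vw.
by rewrite subr_ge0.
Qed.

End EntrywiseLimits.

Lemma complex_cvg (R : realType) (x y : nat -> R) (a b : R) :
  x @ \oo --> a -> y @ \oo --> b ->
  (fun k => (x k +i* y k)%C : R[i]^o) @ \oo --> ((a +i* b)%C : R[i]^o).
Proof.
move=> xa yb; apply/cvgrPdist_lt => e e0.
(* The radius [e] is a positive element of [R[i]], hence real; half of it goes to each
   coordinate. *)
have e2 : 0 < complex.Re e / 2.
  by rewrite divr_gt0 //; move: e0; case: (e) => e1 e2; rewrite ltcE => /andP[].
have eE : e = (complex.Re e)%:C%C by rewrite RRe_real ?gtr0_real.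
move/cvgrPdist_lt/(_ _ e2): xa => xa; move/cvgrPdist_lt/(_ _ e2): yb => yb.
near=> k.
rewrite (_ : _ - _ = (a - x k)%:C + 'i * (b - y k)%:C)%C; last first.
  by simpc.
apply: le_lt_trans (ler_normD _ _) _.
rewrite normrM normCi mul1r.
have nR (z : R) : `|z%:C%C| = `|z|%:C%C.
  by rewrite normc_def /= expr0n addr0 sqrtr_sqr.
rewrite !nR -rmorphD /= eE ltcR (splitr (complex.Re e)) ltrD //.
  by near: k; exact: xa.
by near: k; exact: yb.
Unshelve. all: by end_near. Qed.

(** The real and imaginary parts converge absolutely, by comparison with the geometric series. *)
Lemma complex_series_cvg (R : realType) (a : nat -> R[i]) (q : R) :
  0 <= q < 1 -> (forall k, `|a k| <= (q ^+ k)%:C%C) ->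
  cvgn (series (a : nat -> R[i]^o)).
Proof.
move=> /andP[q0 q1] aq.
have geo : cvgn (series (geometric 1 q)).
  by apply: is_cvg_geometric_series; rewrite ger0_norm.
have cv (b : nat -> R) : (forall k, `|b k| <= q ^+ k) -> cvgn (series b).
  move=> bq; apply: (@normed_cvg _ R^o).
  by apply: series_le_cvg geo => k //=; rewrite mul1r ?exprn_ge0.
have Re_cv : cvgn (series (fun k => complex.Re (a k))).
  by apply: cv => k; rewrite -lecR (le_trans (normc_ge_Re _)).
have Im_cv : cvgn (series (fun k => complex.Im (a k))).
  apply: cv => k; rewrite -lecR; apply: le_trans (aq k).
  by rewrite normc_def lecR -sqrtr_sqr ler_wsqrtr // lerDr sqr_ge0.
apply: cvgP; move: (complex_cvg Re_cv Im_cv).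
apply: cvg_trans; apply: near_eq_cvg; apply: nearW => n /=.
rewrite /series /= -(raddf_sum (@complex.Re R)) -(raddf_sum (@complex.Im R)).
by case: (\sum_(_ <= _ < _) _).
Qed.

(** * Entrywise limits of nc functions *)

Section NcFunctions.
Variables (R : realType) (d : nat) (Omega : ncset R d).

Lemma gfun_sumE (I : Type) (r : seq I) (F : I -> gfun Omega) n (X : Omega n) :
  (\sum_(i <- r) F i) n X = \sum_(i <- r) F i n X.
Proof. by elim/big_rec2: _ => // i A f _ <-. Qed.

Lemma ncmonomialE (w : seq 'I_d) n (X : Omega n) :
  ncmonomial Omega w n X = \prod_(j <- w) \val X j.
Proof. by rewrite /ncmonomial; elim/big_rec2: _ => // i A f _ <-. Qed.

(** Direct sums and products with fixed matrices commute with entrywise limits, so the nc identities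
    survive; the norm bound survives because it can be tested on one vector at a time. *)
Lemma Hinfty_mx_cvg (g : nat -> gfun Omega) (f : gfun Omega) (M : R) :
  (forall k, is_nc (g k)) -> 0 <= M ->
  (forall k n (X : Omega n), opnorm (g k n X) <= M) ->
  (forall n (X : Omega n), mx_cvg (fun k => g k n X) (f n X)) ->
  Hinfty Omega f.
Proof.
move=> g_nc M0 gM gf; split; [split|exists M].
- move=> n m X Y Z ZE; apply: mx_cvg_unique (gf _ Z) _.
  under eq_fun do rewrite ((g_nc _).1 _ _ X Y Z ZE).
  exact: mx_cvg_block.
- move=> n X Y S SU YE; apply: mx_cvg_unique (gf _ Y) _.
  under eq_fun do rewrite ((g_nc _).2 _ X Y S SU YE).
  by apply: mx_cvgMr; apply: mx_cvgMl.
- move=> n X; apply: opnorm_le => // v.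
  rewrite -(@ler_pXn2r _ 2) ?nnegrE ?mulr_ge0 ?l2norm_ge0 //.
  rewrite -lecR l2norm_sqrC cdotE.
  apply: (mx_cvg_sqnorm_le (mx_cvgMr (B := v) (gf n X))) => k.
  rewrite -cdotE -l2norm_sqrC lecR ler_pXn2r ?nnegrE ?mulr_ge0 ?l2norm_ge0 //.
  by rewrite (le_trans (opnormP _ _)) // ler_wpM2r ?l2norm_ge0.
Qed.

End NcFunctions.

(** * Monomials on the polydisk and nilpotent points attached to words *)

Section Polydisk.
Variables (R : realType) (d : nat).

Lemma polydiskP n (X : mxtuple R d n) :
  polydisk R d n X <-> (0 < n)%N /\ forall j, opnorm (X j) < 1.
Proof.
split=> -[n0 X1]; split => //; last exact: bigmax_lt.
by move=> j; apply: le_lt_trans X1; exact: le_bigmax.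
Qed.

Lemma ncmonomial_opnorm (w : seq 'I_d) n (X : polydisk R d n) :
  opnorm (ncmonomial (polydisk R d) w n X) <= 1.
Proof.
rewrite ncmonomialE; have /set_mem/polydiskP[_ X1] := valP X.
elim: w => [|j w IH]; first by rewrite big_nil opnorm1.
rewrite big_cons (le_trans (opnormM _ _)) // -[leRHS]mulr1.
by apply: ler_pM; rewrite ?opnorm_ge0 // ltW.
Qed.

(** The edges labelled [j] of the path [0 -> 1 -> ... -> size w] that spells [w]. Stating the label
    through [prefix] lets the formula extend to products along any word. *)
Definition word_mx (w : seq 'I_d) (j : 'I_d) : 'M[R[i]]_((size w).+1) :=
  \matrix_(a, b) (prefix [:: j] (drop a w) && (b == a.+1 :> nat))%:R.

Lemma word_mx_prod (w v : seq 'I_d) (a b : 'I_((size w).+1)) :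
  (\prod_(j <- v) word_mx w j) a b =
  (prefix v (drop a w) && (b == a + size v :> nat)%N)%:R.
Proof.
elim: v a b => [|j v IH] a b.
  by rewrite big_nil mxE prefix0s addn0 eq_sym.
rewrite big_cons mxE; have [aw|wa] := ltnP a (size w).
  (* The lifted ordinal is the index [a + 1], the only column where row [a] can be nonzero. *)
  rewrite (bigD1 (lift ord0 (Ordinal aw))) //= [X in _ + X]big1 => [|c ca].
    rewrite addr0 mxE IH /= /bump /= add1n eqxx andbT (drop_nth j aw) /=.
    by rewrite prefix0s andbT addSnnS; case: eqP; rewrite ?mul1r ?mul0r.
  by rewrite mxE [X in _ && X]negbTE ?andbF ?mul0r.
rewrite drop_oversize //= big1 // => c _.
by rewrite mxE drop_oversize // mul0r.
Qed.

Lemma word_point (w : seq 'I_d) :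
  exists (X : polydisk R d (size w).+1) (t : R), 0 < t /\
    forall v, ncmonomial (polydisk R d) v _ X 0 ord_max = t%:C%C *+ (v == w).
Proof.
(* This scaling brings all the matrices inside the open polydisk at once; the summand 1 gives
   strictness and a nonzero denominator. *)
pose s : R := (1 + \sum_j opnorm (word_mx w j))^-1.
have D0 : 0 < 1 + \sum_j opnorm (word_mx w j).
  by rewrite ltr_pwDl // sumr_ge0 // => j _; exact: opnorm_ge0.
have s0 : 0 < s by rewrite invr_gt0.
have X1 : polydisk R d _ (fun j => s%:C%C *: word_mx w j).
  apply/polydiskP; split => // j; apply: le_lt_trans (opnormZ _ (ltW s0)) _.
  rewrite mulrC ltr_pdivrMr // mul1r (bigD1 j) //= addrCA ltrDl.
  by rewrite ltr_pwDl // sumr_ge0 // => k _; exact: opnorm_ge0.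
exists (SigSub (mem_set X1)), (s ^+ size w); split; first by rewrite exprn_gt0.
move=> v; rewrite ncmonomialE /=.
have -> : \prod_(j <- v) (s%:C%C *: word_mx w j) =
    (s ^+ size v)%:C%C *: \prod_(j <- v) word_mx w j.
  elim: v => [|j v IH]; first by rewrite !big_nil expr0 scale1r.
  by rewrite !big_cons IH exprS rmorphM /= -scalerAl -scalerAr scalerA.
rewrite mxE word_mx_prod drop0 add0n /=.
(* The corner entry sees only words that lead from 0 to [size w], and a prefix of full length is [w]
   itself. *)
have -> : prefix v w && (size w == size v) = (v == w).
  have [->|vw] := eqVneq v w; first by rewrite prefix_refl eqxx.
  apply: contraNF vw => /andP[/prefixP[u ->]].
  by rewrite size_cat -[X in _ == X]addn0 eqn_add2l => /nilP ->; rewrite cats0.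
by case: eqP => [->|]; rewrite ?mulr1 ?mulr0.
Qed.

End Polydisk.

(** * Coefficients, large monomials and series in the monomial basis *)

Section MonomialBasis.
Variables (R : realType) (d : nat) (H : ncRKHS (polydisk R d)).
Variable e : seq 'I_d -> H.
Hypothesis e_mono : forall w, ncrkhs_fun H (e w) = ncmonomial (polydisk R d) w.
Hypothesis e_basis : orthogonal_basis e.

Let e_gt0 w : 0 < inner H (e w) (e w).
Proof. by rewrite -inner_norm exprn_gt0 // normr_gt0; case: e_basis. Qed.

Let e_orth v w : inner H (e v) (e w) = inner H (e w) (e w) *+ (v == w).
Proof.
by have [->//|/eqP vw] := eqVneq v w; case: e_basis => _ /(_ _ _ vw) ->.
Qed.

(** The corner entry at the point of [w] is represented by a kernel vector [K]. It vanishes on every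
    monomial except [Z^w], so by density [K] is a multiple of [e w]. *)
Lemma monomial_coefficient (w : seq 'I_d) :
  exists (X : polydisk R d (size w).+1) (t : R), [/\ 0 < t,
    forall v, ncmonomial (polydisk R d) v _ X 0 ord_max = t%:C%C *+ (v == w) &
    forall h, ncrkhs_fun H h _ X 0 ord_max * inner H (e w) (e w) =
              t%:C%C * inner H h (e w)].
Proof.
have [X [t [t0 Xt]]] := word_point R w.
exists X, t; split=> // h.
have [K KE] := ncrkhs_kernel H X (delta_mx ord_max 0) (delta_mx 0 0).
have {}KE u : inner H u K = ncrkhs_fun H u _ X 0 ord_max.
  by rewrite -KE cdot_delta.
(* The scalar forced by pairing [K = a *: e w] with [e w], where the entry equals [t]. *)
pose a := t%:C%C / inner H (e w) (e w).
have aC : Num.conj a = a.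
  by apply: geC0_conj; rewrite divr_ge0 ?ler0c ?ltW.
have Ka : K = a *: e w.
  apply/eqP; rewrite -subr_eq0; apply/eqP.
  case: e_basis => _ _ e_dense.
  apply: (orthogonal_dense_eq0 e_dense) => v.
  rewrite innerBr innerZr aC KE e_mono Xt e_orth.
  by case: eqP => _; rewrite ?mulr0 ?subr0 // divfK ?subrr // gt_eqF.
by rewrite -KE Ka innerZr aC mulrAC divfK // gt_eqF.
Qed.

(** Pigeonhole: Cauchy-Schwarz bounds [(d r)^(2k)] by [c] times a sum of [d^k] squared norms, so not
    every term, multiplied by [c], is below [(d r^2)^k]. The constant [c] is the squared norm of the
    kernel vector at the scalar point. *)
Lemma heavy_words (r : R) : (0 < d)%N -> 0 < r < 1 ->
  exists c : R[i], 0 <= c /\ forall k, exists w : seq 'I_d, size w = k /\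
    (d%:R * r%:C%C ^+ 2) ^+ k <= inner H (e w) (e w) * c.
Proof.
move=> d0 /andP[r0 r1].
have X1 : polydisk R d 1 (fun=> r%:C%C *: 1%:M).
  apply/polydiskP; split => // j; apply: le_lt_trans (opnormZ _ (ltW r0)) _.
  by apply: le_lt_trans r1; rewrite ler_piMr ?opnorm1 ?ltW.
pose X : polydisk R d 1 := SigSub (mem_set X1).
have XE w : ncmonomial (polydisk R d) w _ X 0 0 = r%:C%C ^+ size w.
  rewrite ncmonomialE /=.
  have -> : \prod_(j <- w) (r%:C%C *: 1%:M) =
      (r%:C%C ^+ size w)%:M :> 'M[R[i]]_1.
    elim: w => [|j w IH]; first by rewrite big_nil.
    by rewrite big_cons IH exprS scalar_mxM scalemx1.
  by rewrite mxE eqxx.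
have [K KE] := ncrkhs_kernel H X (delta_mx 0 0) (delta_mx 0 0).
have {}KE w : inner H (e w) K = r%:C%C ^+ size w.
  by rewrite -KE cdot_delta e_mono XE.
have rC0 : 0 < r%:C%C by rewrite (ltcR 0).
exists (inner H K K); split=> [|k]; first exact: inner_ge0.
pose g := \sum_(t : k.-tuple 'I_d) e t.
have gK : inner H g K = d%:R ^+ k * r%:C%C ^+ k.
  rewrite inner_suml (eq_bigr (fun=> r%:C%C ^+ k)) => [|t _].
    by rewrite sumr_const card_tuple card_ord -natrX mulr_natl.
  by rewrite KE size_tuple.
have gg : inner H g g = \sum_(t : k.-tuple 'I_d) inner H (e t) (e t).
  rewrite inner_suml; apply: eq_bigr => t _.
  rewrite inner_sumr (bigD1 t) //= big1 ?addr0 // => u ut.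
  have /negPf tu : tval t != tval u by rewrite eq_sym.
  by rewrite e_orth tu.
have cs := cauchy_schwarz (inner H) g K.
apply: contrapT => /forallNP light.
have lt_t (t : k.-tuple 'I_d) : inner H (e t) (e t) * inner H K K <
    (d%:R * r%:C%C ^+ 2) ^+ k.
  rewrite real_ltNge ?ger0_real ?mulr_ge0 ?inner_ge0 //; last first.
    by rewrite exprn_ge0 // mulr_ge0 ?exprn_ge0 ?ler0n ?(ltW rC0).
  by apply/negP => le_t; apply: (light t); rewrite size_tuple.
have : inner H g g * inner H K K <
    \sum_(t : k.-tuple 'I_d) (d%:R * r%:C%C ^+ 2) ^+ k.
  rewrite gg mulr_suml; apply: ltr_sum => //.
  (* Strictness of the sum needs at least one word of length [k]. *)
  by apply/hasP; exists [tuple of nseq k (Ordinal d0)].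
rewrite sumr_const card_tuple card_ord -[X in _ < X]mulr_natl natrX => lt_g.
have := le_lt_trans cs lt_g; rewrite gK.
rewrite ger0_norm ?mulr_ge0 ?exprn_ge0 ?ler0n ?(ltW rC0) //.
rewrite [X in X < _](_ : _ = d%:R ^+ k * (d%:R * r%:C%C ^+ 2) ^+ k) ?ltxx //.
by rewrite [in RHS]exprMn (exprAC _ 2 k); ring.
Qed.

(** Monomials have norm at most 1 on the polydisk, so the partial sums are dominated by the
    geometric series and bounded by [1 / (1 - q)]. *)
Lemma monomial_series (w : nat -> seq 'I_d) (q : R) : 0 <= q < 1 ->
  exists2 f, Hinfty (polydisk R d) f & forall n (X : polydisk R d n),
    mx_cvg (fun N => \sum_(0 <= k < N) (q ^+ k)%:C%C *:
                       ncmonomial (polydisk R d) (w k) n X) (f n X).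
Proof.
move=> q01; have [q0 q1] := andP q01.
pose a n (X : polydisk R d n) i j k :=
  (q ^+ k)%:C%C * ncmonomial (polydisk R d) (w k) n X i j.
have a_cvg n (X : polydisk R d n) i j :
    cvgn (series (a n X i j : nat -> R[i]^o)).
  apply: (complex_series_cvg q01) => k.
  rewrite normrM ger0_norm ?ler0c ?exprn_ge0 // ler_piMr ?ler0c ?exprn_ge0 //.
  apply: le_trans (entry_le_opnorm _ _ _) _.
  by rewrite (lecR _ 1) ncmonomial_opnorm.
pose f : gfun (polydisk R d) := fun n X =>
  \matrix_(i, j) (limn (series (a n X i j : nat -> R[i]^o)) : R[i]).
(* Taking the partial sums as elements of [H] makes them nc by [ncrkhs_nc]. *)
pose g N : gfun (polydisk R d) :=
  ncrkhs_fun H (\sum_(0 <= k < N) (q ^+ k)%:C%C *: e (w k)).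
have gE N n X : g N n X =
    \sum_(0 <= k < N) (q ^+ k)%:C%C *: ncmonomial (polydisk R d) (w k) n X.
  rewrite /g linear_sum gfun_sumE; apply: eq_bigr => k _.
  by rewrite linearZ /= e_mono.
have f_cvg n (X : polydisk R d n) :
    mx_cvg (fun N => \sum_(0 <= k < N) (q ^+ k)%:C%C *:
                       ncmonomial (polydisk R d) (w k) n X) (f n X).
  move=> i j; rewrite mxE; have := a_cvg n X i j; apply: cvg_trans.
  apply: near_eq_cvg; apply: nearW => N; rewrite summxE /series /=.
  by apply: eq_bigr => k _; rewrite mxE.
exists f => //.
apply: (@Hinfty_mx_cvg _ _ _ g _ (1 - q)^-1) => [N||N n X|n X].
- exact: ncrkhs_nc.
- by rewrite invr_ge0 subr_ge0 ltW.
- apply: (@le_trans _ _ (\sum_(0 <= k < N) q ^+ k)).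
    rewrite gE; elim/big_rec2: _ => [|k x y _ IH].
      apply: opnorm_le => // v.
      by rewrite mul0mx mul0r -(scale0r 0) (@l2norm_scale _ _ 0) ?mul0r.
    apply: le_trans (opnormD _ _) _; apply: lerD => //.
    apply: le_trans (opnormZ _ _) _; first by rewrite exprn_ge0.
    by rewrite ler_piMr ?exprn_ge0 ?ncmonomial_opnorm.
  rewrite -[leRHS]mul1r ler_pdivlMr ?subr_gt0 // mulrC big_mkord.
  by rewrite -[X in X * _]opprB mulNr -subrX1 opprB gerBl exprn_ge0.
- by under eq_fun do rewrite gE; exact: f_cvg.
Qed.

End MonomialBasis.

Theorem theorem2p4 (R : realType) (d : nat) (d_ge2 : (2 <= d)%N)
  (H : ncRKHS (polydisk R d))
  (polys_in_H :
     (ncpolynomials (polydisk R d) `<=` ncrkhs_functions H)%classic)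
  (monomials_basis : monomials_orthogonal_basis H) :
  Mult H <> Hinfty (polydisk R d).
Proof.
move=> MultE; have [e [e_mono e_basis]] := monomials_basis.
(* Here [d r^4 >= 2 * 0.6561 > 1.3] and [1.3^3 > 2]; the cube turns growth in [k] into growth at
   least as fast as powers of 2. *)
have [r r01 dr] : exists2 r : R, 0 < r < 1 & 2%:R <= (d%:R * r ^+ 4) ^+ 3.
  have d2 : 2%:R <= d%:R :> R by rewrite ler_nat.
  exists (9%:R / 10%:R); first by lra.
  have dr : 13%:R / 10%:R <= d%:R * (9%:R / 10%:R) ^+ 4 :> R.
    by apply: le_trans (ler_wpM2r _ d2); lra.
  by apply: le_trans (lerXn2r 3 _ _ dr); rewrite ?nnegrE; lra.
have rC0 : 0 < r%:C%C by rewrite (ltcR 0); case/andP: r01.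
have [c [c0 heavy]] := heavy_words e_mono e_basis (ltnW d_ge2) r01.
have [w wP] := choice heavy.
have q01 : 0 <= r < 1 by case/andP: r01 => /ltW -> ->.
have [f fHinf f_cvg] := monomial_series e_mono w q01.
(* The function 1 is the monomial of the empty word, so the multiplier [f] sends it to [f]
   itself. *)
have [h _ hE] : ncrkhs_functions H f.
  rewrite -[f]mulr1; move: fHinf; rewrite -MultE => -[_]; apply.
  by exists (e [::]) => //; rewrite e_mono /ncmonomial big_nil.
have bound k : (d%:R * r%:C%C ^+ 4) ^+ k <= inner H h h * c.
  have [wk lek] := wP k.
  have [X [t [t0 Xt hX]]] := monomial_coefficient e_mono e_basis (w k).
  have fX : f _ X 0 ord_max = (r ^+ k)%:C%C * t%:C%C.
    apply: norm_cvg_unique (f_cvg _ X 0 ord_max) _.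
    (* The words [w m] have distinct lengths, so only the term [k] contributes, and it is present as
       soon as [N >= k + 1]. *)
    apply: cvg_near_cst; exists k.+1 => // N /= kN.
    rewrite summxE (bigD1_seq k) ?iota_uniq ?mem_index_iota //= big1 => [|m mk].
      by rewrite mxE Xt eqxx addr0.
    rewrite mxE Xt [_ == _](_ : _ = false) ?mulr0 //.
    apply: contraNF mk => /eqP /(congr1 size).
    by rewrite wk (wP m).1 => ->.
  have W0 : 0 < inner H (e (w k)) (e (w k)).
    by rewrite -inner_norm exprn_gt0 // normr_gt0; case: e_basis.
  have he : inner H h (e (w k)) = r%:C%C ^+ k * inner H (e (w k)) (e (w k)).
    apply: (mulfI (x := t%:C%C)); first by rewrite gt_eqF // (ltcR 0).
    by rewrite -hX hE fX rmorphXn /=; ring.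
  have := cauchy_schwarz (inner H) h (e (w k)).
  rewrite he ger0_norm ?mulr_ge0 ?exprn_ge0 ?(ltW W0) ?(ltW rC0) //.
  (* One factor [|e (w k)|^2] cancels, leaving [r^(2k) |e (w k)|^2 <= |h|^2], which meets the lower
     bound [lek] after multiplication by [c]. *)
  rewrite exprMn [X in _ * X]expr2 mulrA ler_pM2r // => hW.
  apply: le_trans (ler_wpM2r c0 hW); rewrite -mulrA.
  apply: le_trans (ler_wpM2l _ lek); last by rewrite !exprn_ge0 ?(ltW rC0).
  rewrite (exprAC _ k 2) -exprMn.
  by rewrite [X in _ <= X ^+ k](_ : _ = d%:R * r%:C%C ^+ 4) //; ring.
set M := inner H h h * c in bound.
have ME : (complex.Re M)%:C%C = M.
  by apply: RRe_real; apply: ger0_real; exact: mulr_ge0 (inner_ge0 _) c0.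
(* With [n] the archimedean bound of [M], [M < 2^n], whereas [bound] at [3n] gives [2^n <= M]. *)
have := upper_nthrootP (leqnn (Num.bound (complex.Re M))).
rewrite ltNge => /negP; apply; rewrite -lecR ME.
apply: le_trans (bound (3 * Num.bound (complex.Re M))%N).
have -> : d%:R * r%:C%C ^+ 4 = (d%:R * r ^+ 4)%:C%C.
  by rewrite rmorphM /= rmorph_nat rmorphXn.
rewrite -[leRHS]rmorphXn /= lecR exprM lerXn2r ?nnegrE //.
by case/andP: r01 => /ltW r0 _; rewrite exprn_ge0 // mulr_ge0 ?exprn_ge0.
Qed.
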